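(* For every nonzero real number $x$, $$\left.\frac{\partial \mathrm{Wi}_{\alpha,\beta}(x)}{\partial\beta}\right|_{\alpha=1,\ \beta=0}=-\gamma-\frac12\ln x\,I_0(2\sqrt x)-K_0(2\sqrt x)+x\,{}_2F_3\left(1,1;\,2,2,2;\,x\right).$$
   Context: The integral Wright function is $\mathrm{Wi}_{\alpha,\beta}(x)=\sum_{k=1}^\infty\frac{x^k}{k\,k!\,\Gamma(\alpha k+\beta)}$ (with $1/\Gamma=0$ at the poles of $\Gamma$), so that $\frac{\partial \mathrm{Wi}_{\alpha,\beta}(x)}{\partial\beta}=-\sum_{k=1}^\infty\frac{\psi(\alpha k+\beta)}{k\,k!\,\Gamma(\alpha k+\beta)}x^k$, with $\psi=\Gamma'/\Gamma$ the digamma function. $\gamma$ is the Euler-Mascheroni constant; $I_\nu$ and $K_\nu$ are the modified Bessel functions of the first and second kind; ${}_pF_q(a_1,\dots,a_p;b_1,\dots,b_q;z)$ is the generalized hypergeometric function. For $x<0$, $\ln x$ and $\sqrt x$ denote principal branches. *)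

(* Defs.v *)
From Stdlib Require Import Reals ZArith List.
From Coquelicot Require Import Coquelicot.
Import ListNotations.

Open Scope R_scope.

Fixpoint pochhammer (x : R) (n : nat) : R :=
  match n with
  | O => 1
  | S m => pochhammer x m * (x + INR m)
  end.

(* Meaningful for [0 < x] only. *)
Definition Euler_integral (x : R) : R :=
  RInt_gen (fun t => Rpower t (x - 1) * exp (- t))
           (at_right 0) (Rbar_locally p_infty).

(* A number of steps [n] with [0 < x + n]; it is 0 when [0 < x]. *)
Definition gamma_shift (x : R) : nat := Z.to_nat (up (- x)).

(* The entire function 1/Gamma, where Gamma is the Euler integral for [0 < x],
   extended by Gamma (x + n) = x (x + 1) ... (x + n - 1) Gamma x.  At the poles
   of Gamma, i.e. [x = 0, -1, -2, ...], the numerator vanishes. *)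
Definition rGamma (x : R) : R :=
  let n := gamma_shift x in
  pochhammer x n / Euler_integral (x + INR n).

(* The term of index 0 is a dummy value, irrelevant for the limit. *)
Definition euler_gamma : R :=
  real (Lim_seq (fun n => sum_n_m (fun k => / INR k) 1 n - ln (INR n))).

(* The summation index is shifted by one: [k = S n] runs over k >= 1. *)
Definition Wi (alpha beta x : R) : R :=
  Series (fun n => let k := S n in
    x ^ k / (INR k * INR (fact k)) * rGamma (alpha * INR k + beta)).

Definition pochhammer_prod (a : list R) (n : nat) : R :=
  fold_right Rmult 1 (map (fun c => pochhammer c n) a).

Definition pFq (a b : list R) (z : R) : R :=
  Series (fun n =>
    pochhammer_prod a n / pochhammer_prod b n * (z ^ n / INR (fact n))).

Definition Cexp (z : C) : C :=
  (exp (Re z) * cos (Im z), exp (Re z) * sin (Im z)).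

(* Principal argument, in (-PI, PI], for [z <> 0]. *)
Definition Carg (z : C) : R :=
  if Rle_dec 0 (Im z) then acos (Re z / Cmod z) else - acos (Re z / Cmod z).

(* [Clog], [Cpower] and [Csqrt] are only meaningful for [z <> 0]. *)
Definition Clog (z : C) : C := (ln (Cmod z), Carg z).

Definition Cpower (z : C) (s : R) : C := Cexp (RtoC s * Clog z)%C.

Definition Csqrt (z : C) : C := Cpower z (/ 2).

Definition CSeries (a : nat -> C) : C :=
  (Series (fun n => Re (a n)), Series (fun n => Im (a n))).

(* Punctured limit at a real point of a complex-valued function. *)
Definition CLim (f : R -> C) (a : R) : C :=
  (real (Lim (fun t => Re (f t)) a), real (Lim (fun t => Im (f t)) a)).

Definition BesselI (nu : R) (z : C) : C :=
  (Cpower (z / RtoC 2) nu *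
   CSeries (fun k => (z * z / RtoC 4) ^ k *
                     RtoC (rGamma (nu + INR k + 1) / INR (fact k))))%C.

Definition BesselK_quotient (nu : R) (z : C) : C :=
  (RtoC (PI / 2) * (BesselI (- nu) z - BesselI nu z) / RtoC (sin (nu * PI)))%C.

(* For integer order, where [sin (nu * PI) = 0], K is the limit over the order. *)
Definition BesselK (nu : R) (z : C) : C :=
  if Req_dec_T (sin (nu * PI)) 0
  then CLim (fun mu => BesselK_quotient mu z) nu
  else BesselK_quotient nu z.

(* Main.v *)
Require Import Defs.
From Stdlib Require Import Reals List Lra Lia Factorial ZArith Classical.
From Coquelicot Require Import Coquelicot.
Import ListNotations.
Open Scope R_scope.

(** At [alpha = 1] every coefficient of [Wi] is a value [1/Gamma(1+b+n)] with
    [b] near 0, and the recurrence of Gamma gives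
    [1/Gamma(1+b+n) = 1/Gamma(1+b) * 1/(1+b)_n], where [(1+b)_n] is the rising
    factorial.  So the whole dependence on [b] sits in the single factor
    [1/Gamma(1+b)] and in rational functions of [b]:
    [[
      Wi(1,b,x)        = 1/Gamma(1+b) * sum_n x^(n+1)/((n+1)(n+1)!) / (1+b)_n,
      x^(-b/2) I_b(2 sqrt x) = 1/Gamma(1+b) * sum_n x^n/n! / (1+b)_n =: S(b).
    ]]
    Two facts then suffice to differentiate at [b = 0].

    The first is that [1/Gamma(1+b)] has derivative [euler_gamma] at 0
    ([is_derive_rGamma_1]).  No differentiation under the integral sign is
    used: integrating Bernoulli's inequality gives
    [Gamma(x+p) <= x^p Gamma(x)] for [0 <= p <= 1], which pins the slopes of
    [ln Gamma] between [m+1] and [m+1+s] to [ln m] up to [1/m]; the recurrence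
    carries this down to [Gamma(1+s)] at the cost of [ln (1+s)_m], whose
    derivative at 0 is the harmonic number [H_m], and [H_m - ln m] tends to
    [euler_gamma].

    The second is that [1/(1+b)_n] equals [1/n! - b H_n/n!] up to
    [10^n b^2] for [|b| <= 1/2]; since the series above converge even with an
    extra factor [10^n], they are differentiable term by term
    ([is_derive_Series_inv_pochhammer]).

    On the Bessel side write [L = (ln x)/2], so that [I_b(2 sqrt x) =
    exp(b L) S(b)], also for [x < 0] with principal branches.  The limit
    that defines [K_0] is minus the derivative of this product, so
    [- L I_0 - K_0 = S'(0)]: the logarithms cancel and only
    [S'(0) = euler_gamma T + T'] is left, with [T] and [T'] the value and the
    derivative at 0 of [sum_n x^n/n! / (1+b)_n].  For [Wi] the same rule gives
    [euler_gamma (T - 1)] plus a series that the identity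
    [H_(n+1) = H_n + 1/(n+1)] splits into [T'] and
    [sum_(k >= 1) x^k/(k k!^2) = x 2F3(1,1;2,2,2;x)]. *)

(** * Euler's integral *)

Lemma ln_le_sub_1 (y : R) : 0 < y -> ln y <= y - 1.
Proof.
  intros Hy. pose proof (exp_ineq1_le (ln y)) as H.
  rewrite exp_ln in H by exact Hy. lra.
Qed.

Lemma filter_prod_0_infty (P : R * R -> Prop) (a0 b0 : R) :
  0 < a0 ->
  (forall a b, 0 < a < a0 -> b0 < b -> P (a, b)) ->
  filter_prod (at_right 0) (Rbar_locally p_infty) P.
Proof.
  intros Ha0 H.
  apply Filter_prod with (Q := fun a => 0 < a < a0) (R := fun b => b0 < b).
  - exists (mkposreal a0 Ha0). intros y Hy Hy0.
    change (Rabs (y - 0) < a0) in Hy. split; [exact Hy0|]. apply Rabs_def2 in Hy. lra.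
  - exists b0. auto.
  - intros a b Ha Hb. apply H; assumption.
Qed.

(** For a nonnegative integrand the integrals over [[a, b]] grow with the
    interval, so the improper integral is their supremum; the increments of the
    bounded primitive [H] of the dominating [h] keep that supremum finite. *)
Lemma is_RInt_gen_dominated (f h H : R -> R) (M : R) :
  (forall t, 0 < t -> continuous f t) ->
  (forall t, 0 < t -> 0 <= f t <= h t) ->
  (forall t, 0 < t -> is_derive H t (h t)) ->
  (forall t, 0 < t -> continuous h t) ->
  (forall t, 0 < t -> 0 <= H t <= M) ->
  exists l, is_RInt_gen f (at_right 0) (Rbar_locally p_infty) l /\
    forall a b, 0 < a < b -> RInt f a b <= l.
Proof.
  intros Cf Bf DH Ch BH.
  assert (Ef : forall a b, 0 < a -> 0 < b -> ex_RInt f a b).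
  { intros a b Ha Hb. apply (@ex_RInt_continuous R_CompleteNormedModule).
    intros z Hz. apply Cf. apply Rlt_le_trans with (2 := proj1 Hz).
    apply Rmin_glb_lt; assumption. }
  set (E := fun v => exists a b, 0 < a < b /\ v = RInt f a b).
  destruct (completeness E) as [l [Hub Hlub]].
  - exists M. intros v [a [b [Hab ->]]].
    assert (Hmin : forall z, Rmin a b <= z <= Rmax a b -> 0 < z).
    { intros z Hz. apply Rlt_le_trans with (2 := proj1 Hz).
      apply Rmin_glb_lt; lra. }
    assert (IH : is_RInt h a b (minus (H b) (H a))).
    { apply (@is_RInt_derive R_CompleteNormedModule); intros z Hz;
        [apply DH | apply Ch]; apply Hmin; exact Hz. }
    apply Rle_trans with (minus (H b) (H a)).
    + apply (is_RInt_le f h a b); [lra | | exact IH |].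
      * apply (@RInt_correct R_CompleteNormedModule). apply Ef; lra.
      * intros z Hz. apply Bf; lra.
    + unfold minus, plus, opp; simpl.
      pose proof (BH a ltac:(lra)). pose proof (BH b ltac:(lra)). lra.
  - exists (RInt f 1 2). exists 1, 2. split; [lra | reflexivity].
  - exists l. split.
    + intros P [eps HP].
      assert (Hex : exists a0 b0, 0 < a0 < b0 /\ l - eps < RInt f a0 b0).
      { apply NNPP. intros Hn.
        assert (Hle : l <= l - eps).
        { apply Hlub. intros v [a [b [Hab ->]]].
          destruct (Rle_lt_dec (RInt f a b) (l - eps)); [assumption|].
          exfalso; apply Hn; exists a, b; split; assumption. }
        pose proof (cond_pos eps). lra. }
      destruct Hex as [a0 [b0 [H0 Hl]]].
      apply (filter_prod_0_infty _ a0 b0); [lra|].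
      intros a b Ha Hb. simpl. exists (RInt f a b). split.
      * apply (@RInt_correct R_CompleteNormedModule). apply Ef; lra.
      * apply HP. change (Rabs (RInt f a b - l) < eps).
        assert (Hup : RInt f a b <= l)
          by (apply Hub; exists a, b; split; [lra|reflexivity]).
        assert (Hpos : forall c d, 0 < c <= d -> 0 <= RInt f c d).
        { intros c d Hcd. apply RInt_ge_0; [lra | apply Ef; lra |].
          intros z Hz. apply Bf. lra. }
        assert (Hspl : RInt f a b = RInt f a a0 + RInt f a0 b0 + RInt f b0 b).
        { rewrite <- (@RInt_Chasles R_CompleteNormedModule f a a0 b) by (apply Ef; lra).
          rewrite <- (@RInt_Chasles R_CompleteNormedModule f a0 b0 b) by (apply Ef; lra).
          unfold plus; simpl. ring. }
        pose proof (Hpos a a0 ltac:(lra)). pose proof (Hpos b0 b ltac:(lra)).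
        apply Rabs_def1; lra.
    + intros a b Hab. apply Hub. exists a, b. split; [assumption|reflexivity].
Qed.

Definition gamma_integrand (x t : R) : R := Rpower t (x - 1) * exp (- t).

Lemma gamma_integrand_pos (x t : R) : 0 < gamma_integrand x t.
Proof. apply Rmult_lt_0_compat; apply exp_pos. Qed.

Lemma gamma_integrand_continuous (x t : R) :
  0 < t -> continuous (gamma_integrand x) t.
Proof.
  intros Ht. apply (@ex_derive_continuous R_AbsRing R_NormedModule).
  unfold gamma_integrand, Rpower. auto_derive. exact Ht.
Qed.

(** [y ln (1+t) - t] is bounded because [ln] lies below its tangent at [y]. *)
Lemma Rpower_le_exp (y : R) :
  0 < y -> exists K, 0 < K /\ forall t, 0 < t -> Rpower (1 + t) y * exp (- t) <= K.
Proof.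
  intros Hy. exists (exp (1 + y * ln y)). split; [apply exp_pos|].
  intros t Ht. unfold Rpower. rewrite <- exp_plus.
  assert (Hln : ln ((1 + t) / y) <= (1 + t) / y - 1)
    by (apply ln_le_sub_1, Rdiv_lt_0_compat; lra).
  rewrite ln_div in Hln by lra.
  assert (Hle : y * ln (1 + t) + - t <= 1 + y * ln y).
  { apply (Rmult_le_compat_l y) in Hln; [|lra].
    replace (y * ((1 + t) / y - 1)) with (1 + t - y) in Hln by (field; lra).
    lra. }
  destruct Hle as [Hlt | ->]; [left; apply exp_increasing, Hlt | right; reflexivity].
Qed.

(** A single dominating primitive serves both ends: [(K/x) (t/(1+t))^x] is
    bounded on the half line, and its derivative
    [K t^(x-1) (1+t)^(-x-1)] exceeds [t^(x-1) exp(-t)] as soon as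
    [(1+t)^(x+1) exp(-t) <= K].  The positivity of Gamma is read off the
    lower bounds [RInt _ a b <= l]. *)
Lemma gamma_integral_converges (x : R) :
  0 < x ->
  exists l, is_RInt_gen (gamma_integrand x) (at_right 0) (Rbar_locally p_infty) l /\
    forall a b, 0 < a < b -> RInt (gamma_integrand x) a b <= l.
Proof.
  intros Hx. destruct (Rpower_le_exp (x + 1) ltac:(lra)) as [K [HK Hexp]].
  assert (Dom : forall t, 0 < t -> is_derive
    (fun t => K / x * Rpower (t / (1 + t)) x) t
    (K * Rpower t (x - 1) * Rpower (1 + t) (- (x + 1)))).
  { intros t Ht. unfold Rpower. auto_derive.
    - split; [lra|]. split; [apply Rdiv_lt_0_compat; lra|trivial].
    - replace (t * / (1 + t)) with (t / (1 + t)) by reflexivity.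
      rewrite ln_div by lra.
      replace (x * (ln t - ln (1 + t))) with
        ((x - 1) * ln t + - (x + 1) * ln (1 + t) + (ln t + ln (1 + t))) by ring.
      rewrite !exp_plus, !exp_ln by lra. field. lra. }
  apply (is_RInt_gen_dominated _
    (fun t => K * Rpower t (x - 1) * Rpower (1 + t) (- (x + 1)))
    (fun t => K / x * Rpower (t / (1 + t)) x) (K / x)).
  - intros t Ht. apply gamma_integrand_continuous, Ht.
  - intros t Ht. split; [left; apply gamma_integrand_pos|].
    unfold gamma_integrand. rewrite Rpower_Ropp.
    replace (K * Rpower t (x - 1) * / Rpower (1 + t) (x + 1)) with
      (Rpower t (x - 1) * (K / Rpower (1 + t) (x + 1))) by (unfold Rdiv; ring).
    apply Rmult_le_compat_l; [left; apply exp_pos|].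
    apply (Rmult_le_reg_l (Rpower (1 + t) (x + 1))); [apply exp_pos|].
    replace (Rpower (1 + t) (x + 1) * (K / Rpower (1 + t) (x + 1))) with K
      by (field; apply Rgt_not_eq, exp_pos).
    apply Hexp, Ht.
  - exact Dom.
  - intros t Ht. apply (@ex_derive_continuous R_AbsRing R_NormedModule).
    unfold Rpower. auto_derive. lra.
  - intros t Ht.
    assert (Hq : 0 < K / x) by (apply Rdiv_lt_0_compat; lra).
    split; [left; apply Rmult_lt_0_compat; [exact Hq|apply exp_pos]|].
    rewrite <- (Rmult_1_r (K / x)) at 2.
    apply Rmult_le_compat_l; [lra|].
    apply Rle_trans with (exp 0); [left; apply exp_increasing | rewrite exp_0; lra].
    assert (ln (t / (1 + t)) < 0).
    { rewrite <- ln_1. apply ln_increasing; [apply Rdiv_lt_0_compat; lra|].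
      apply (Rmult_lt_reg_r (1 + t)); [lra|]. field_simplify; lra. }
    rewrite <- (Rmult_0_r x). apply Rmult_lt_compat_l; assumption.
Qed.

Lemma Euler_integral_correct (x : R) :
  0 < x ->
  is_RInt_gen (gamma_integrand x) (at_right 0) (Rbar_locally p_infty)
    (Euler_integral x).
Proof.
  intros Hx. apply (@RInt_gen_correct R_CompleteNormedModule _ _ _ _).
  destruct (gamma_integral_converges x Hx) as [l [Hl _]]. exists l; exact Hl.
Qed.

Lemma Euler_integral_unique (x l : R) :
  is_RInt_gen (gamma_integrand x) (at_right 0) (Rbar_locally p_infty) l ->
  Euler_integral x = l.
Proof.
  intros H. exact (@is_RInt_gen_unique R_CompleteNormedModule _ _ _ _ _ _ H).
Qed.

Lemma Euler_integral_pos (x : R) : 0 < x -> 0 < Euler_integral x.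
Proof.
  intros Hx. destruct (gamma_integral_converges x Hx) as [l [Hl Hle]].
  rewrite (Euler_integral_unique x l Hl).
  apply Rlt_le_trans with (2 := Hle 1 2 ltac:(lra)).
  apply RInt_gt_0; [lra | intros; apply gamma_integrand_pos |].
  intros t Ht. apply gamma_integrand_continuous. lra.
Qed.

Lemma is_RInt_gen_Derive_0_infty (F f : R -> R) (l0 l1 : R) :
  (forall t, 0 < t -> is_derive F t (f t)) ->
  (forall t, 0 < t -> continuous f t) ->
  filterlim F (at_right 0) (locally l0) ->
  filterlim F (Rbar_locally p_infty) (locally l1) ->
  is_RInt_gen f (at_right 0) (Rbar_locally p_infty) (l1 - l0).
Proof.
  intros DF Cf H0 H1.
  assert (Hpos : forall a b z, 0 < a < 1 -> 1 < b -> Rmin a b <= z -> 0 < z).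
  { intros a b z Ha Hb Hz. rewrite Rmin_left in Hz by lra. lra. }
  apply (is_RInt_gen_ext (Derive F) f).
  { apply (filter_prod_0_infty _ 1 1); [lra|]. intros a b Ha Hb z Hz. simpl in Hz.
    apply is_derive_unique, DF, (Hpos a b); try assumption. lra. }
  apply is_RInt_gen_Derive; try assumption;
    apply (filter_prod_0_infty _ 1 1); try lra; intros a b Ha Hb z Hz; simpl in Hz;
    assert (Hz0 : 0 < z) by (apply (Hpos a b); try assumption; lra).
  - exists (f z). apply DF, Hz0.
  - apply continuous_ext_loc with (g := f); [|apply Cf, Hz0].
    exists (mkposreal z Hz0). intros y Hy.
    change (Rabs (y - z) < z) in Hy. apply Rabs_def2 in Hy.
    symmetry. apply is_derive_unique, DF. lra.
Qed.

Lemma Euler_integral_1 : Euler_integral 1 = 1.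
Proof.
  apply Euler_integral_unique. replace 1 with (0 - (-1)) at 2 by ring.
  apply (is_RInt_gen_Derive_0_infty (fun t => - exp (- t))).
  - intros t Ht. unfold gamma_integrand, Rpower. auto_derive; [trivial|].
    replace ((1 - 1) * ln t) with 0 by ring. rewrite exp_0. ring.
  - intros t Ht. apply gamma_integrand_continuous, Ht.
  - apply (filterlim_filter_le_1 (F := locally 0) (fun t => - exp (- t)));
      [apply filter_le_within|].
    replace (-1) with (- exp (- 0)) by (rewrite Ropp_0, exp_0; ring).
    apply (@ex_derive_continuous R_AbsRing R_NormedModule (fun t => - exp (- t)) 0).
    auto_derive. trivial.
  - replace 0 with (- 0) by ring.
    apply (is_lim_opp (fun t => exp (- t)) p_infty 0).
    apply (is_lim_comp exp Ropp p_infty 0 m_infty).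
    + apply is_lim_exp_m.
    + apply (is_lim_opp (fun t => t) p_infty p_infty), is_lim_id.
    + exists 0. intros; discriminate.
Qed.

(** Integration by parts: [t^x exp(-t)] vanishes at both ends. *)
Lemma Euler_integral_succ (x : R) :
  0 < x -> Euler_integral (x + 1) = x * Euler_integral x.
Proof.
  intros Hx.
  assert (Hparts : is_RInt_gen
    (fun t => x * gamma_integrand x t - gamma_integrand (x + 1) t)
    (at_right 0) (Rbar_locally p_infty) (0 - 0)).
  { apply (is_RInt_gen_Derive_0_infty (fun t => Rpower t x * exp (- t))).
    - intros t Ht. unfold gamma_integrand, Rpower. auto_derive; [exact Ht|].
      replace (x + 1 - 1) with x by ring.
      replace (x * ln t) with ((x - 1) * ln t + ln t) by ring.
      rewrite exp_plus, exp_ln by exact Ht. field. lra.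
    - intros t Ht. apply (@ex_derive_continuous R_AbsRing R_NormedModule).
      unfold gamma_integrand, Rpower. auto_derive. lra.
    - intros P [eps HP].
      exists (mkposreal (exp (ln eps / x)) (exp_pos _)). intros t Ht Ht0. apply HP.
      change (Rabs (t - 0) < exp (ln eps / x)) in Ht.
      change (Rabs (Rpower t x * exp (- t) - 0) < eps).
      apply Rabs_def2 in Ht. rewrite Rminus_0_r in *.
      assert (0 < Rpower t x * exp (- t)) by (apply Rmult_lt_0_compat; apply exp_pos).
      rewrite Rabs_pos_eq by lra.
      assert (Hlt : Rpower t x < eps).
      { rewrite <- (exp_ln eps) by apply cond_pos. apply exp_increasing.
        assert (ln t < ln eps / x) by (rewrite <- (ln_exp (ln eps / x)); apply ln_increasing; lra).
        replace (ln eps) with (x * (ln eps / x)) by (field; lra).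
        apply Rmult_lt_compat_l; assumption. }
      assert (exp (- t) < 1) by (rewrite <- exp_0; apply exp_increasing; lra).
      pose proof (exp_pos (- t)). pose proof (exp_pos (x * ln t)).
      unfold Rpower in *. nra.
    - destruct (Rpower_le_exp (x + 1) ltac:(lra)) as [K [HK Hexp]].
      intros P [eps HP]. exists (Rmax 0 (K / eps)). intros t Ht. apply HP.
      pose proof (Rmax_l 0 (K / eps)). pose proof (Rmax_r 0 (K / eps)).
      change (Rabs (Rpower t x * exp (- t) - 0) < eps). rewrite Rminus_0_r.
      assert (0 < Rpower t x * exp (- t)) by (apply Rmult_lt_0_compat; apply exp_pos).
      rewrite Rabs_pos_eq by lra.
      specialize (Hexp t ltac:(lra)).
      rewrite Rpower_plus, Rpower_1 in Hexp by lra.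
      assert (Hmono : Rpower t x <= Rpower (1 + t) x) by (apply Rle_Rpower_l; lra).
      (* From the exponential bound, [t * (t^x exp(-t)) <= K < t * eps]. *)
      assert (Ht' : K < t * eps).
      { apply (Rmult_lt_reg_r (/ eps)); [apply Rinv_0_lt_compat, cond_pos|].
        rewrite Rmult_assoc, Rinv_r by (apply Rgt_not_eq, cond_pos). unfold Rdiv in *; lra. }
      apply (Rmult_lt_reg_l t); [lra|].
      pose proof (exp_pos (- t)). pose proof (exp_pos (x * ln t)).
      apply Rle_lt_trans with (2 := Ht').
      apply Rle_trans with (2 := Hexp).
      rewrite <- Rmult_assoc. apply Rmult_le_compat_r; [lra|].
      unfold Rpower in *. nra. }
  assert (Hlin : is_RInt_gen
    (fun t => x * gamma_integrand x t - gamma_integrand (x + 1) t)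
    (at_right 0) (Rbar_locally p_infty)
    (x * Euler_integral x - Euler_integral (x + 1))).
  { apply (is_RInt_gen_minus (fun t => x * gamma_integrand x t)).
    - apply (is_RInt_gen_scal (gamma_integrand x)), Euler_integral_correct, Hx.
    - apply Euler_integral_correct. lra. }
  assert (Heq : x * Euler_integral x - Euler_integral (x + 1) = 0 - 0).
  { rewrite <- (@is_RInt_gen_unique R_CompleteNormedModule _ _ _ _ _ _ Hlin).
    exact (@is_RInt_gen_unique R_CompleteNormedModule _ _ _ _ _ _ Hparts). }
  lra.
Qed.

(** Bernoulli's inequality, as the weighted arithmetic-geometric mean inequality
    of [1] and [u] with weights [1-p] and [p]: apply [ln y <= y - 1] to both
    after dividing them by their weighted mean. *)
Lemma Rpower_le_tangent (u p : R) :
  0 < u -> 0 <= p <= 1 -> Rpower u p <= 1 + p * (u - 1).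
Proof.
  intros Hu Hp. set (m := 1 + p * (u - 1)).
  assert (Hm : 0 < m) by (unfold m; nra).
  assert (H1 : ln (/ m) <= / m - 1) by (apply ln_le_sub_1, Rinv_0_lt_compat, Hm).
  assert (H2 : ln (u / m) <= u / m - 1) by (apply ln_le_sub_1, Rdiv_lt_0_compat; assumption).
  rewrite ln_Rinv in H1 by exact Hm. rewrite ln_div in H2 by assumption.
  assert (Hln : p * ln u <= ln m).
  { assert (Hsum : (1 - p) * (/ m - 1) + p * (u / m - 1) = 0)
      by (unfold m; field; fold m; lra).
    nra. }
  unfold Rpower. rewrite <- (exp_ln m) by exact Hm.
  destruct Hln as [Hlt | ->]; [left; apply exp_increasing, Hlt | right; reflexivity].
Qed.

(** The one consequence of the log-convexity of Gamma that is needed.  Bernoulli's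
    inequality for [t/x] bounds the integrand by a combination of those of
    [Gamma(x)] and [Gamma(x+1) = x Gamma(x)], in which the weights
    [1-p] and [p] add up to one. *)
Lemma Euler_integral_add_le (x p : R) :
  0 < x -> 0 <= p <= 1 -> Euler_integral (x + p) <= Rpower x p * Euler_integral x.
Proof.
  intros Hx Hp.
  assert (Hmaj : is_RInt_gen
    (fun t => Rpower x p *
       ((1 - p) * gamma_integrand x t + p / x * gamma_integrand (x + 1) t))
    (at_right 0) (Rbar_locally p_infty)
    (Rpower x p * ((1 - p) * Euler_integral x + p / x * Euler_integral (x + 1)))).
  { apply (is_RInt_gen_scal
      (fun t => (1 - p) * gamma_integrand x t + p / x * gamma_integrand (x + 1) t)).
    apply (is_RInt_gen_plus (fun t => (1 - p) * gamma_integrand x t)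
             (fun t => p / x * gamma_integrand (x + 1) t)).
    - apply (is_RInt_gen_scal (gamma_integrand x)), Euler_integral_correct, Hx.
    - apply (is_RInt_gen_scal (gamma_integrand (x + 1))), Euler_integral_correct. lra. }
  rewrite Euler_integral_succ in Hmaj by exact Hx.
  replace ((1 - p) * Euler_integral x + p / x * (x * Euler_integral x))
    with (Euler_integral x) in Hmaj by (field; lra).
  apply Rle_trans with (norm (Euler_integral (x + p))); [apply Rle_abs|].
  pose proof (Euler_integral_correct (x + p) ltac:(lra)) as Hint.
  refine (@RInt_gen_norm R_CompleteNormedModule (at_right 0) (Rbar_locally p_infty)
    _ _ _ _ _ _ _ _ Hint Hmaj).
  - apply (filter_prod_0_infty _ 1 1); [lra|]. intros; simpl; lra.
  - apply (filter_prod_0_infty _ 1 1); [lra|]. intros a b Ha Hb t Ht. simpl in Ht.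
    assert (Ht0 : 0 < t) by lra.
    change (Rabs (gamma_integrand (x + p) t) <= Rpower x p *
       ((1 - p) * gamma_integrand x t + p / x * gamma_integrand (x + 1) t)).
    rewrite Rabs_pos_eq by (left; apply gamma_integrand_pos).
    pose proof (Rpower_le_tangent (t / x) p ltac:(apply Rdiv_lt_0_compat; lra) Hp) as Htan.
    assert (Hsplit : gamma_integrand (x + p) t =
      Rpower x p * (Rpower (t / x) p * gamma_integrand x t)).
    { unfold gamma_integrand, Rpower. rewrite ln_div by lra.
      rewrite <- !exp_plus. f_equal. ring. }
    assert (Hnext : gamma_integrand (x + 1) t = t * gamma_integrand x t).
    { unfold gamma_integrand. replace (x + 1 - 1) with (x - 1 + 1) by ring.
      rewrite Rpower_plus, Rpower_1 by exact Ht0. ring. }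
    rewrite Hsplit, Hnext.
    apply Rmult_le_compat_l; [left; apply exp_pos|].
    apply Rle_trans with ((1 + p * (t / x - 1)) * gamma_integrand x t).
    + apply Rmult_le_compat_r; [left; apply gamma_integrand_pos | exact Htan].
    + right. field. lra.
Qed.

(** * The Euler-Mascheroni constant *)

Definition harmonic (n : nat) : R := sum_n_m (fun k => / INR k) 1 n.

Lemma harmonic_0 : harmonic 0 = 0.
Proof. unfold harmonic. rewrite sum_n_m_zero by lia. reflexivity. Qed.

Lemma harmonic_S (n : nat) : harmonic (S n) = harmonic n + / INR (S n).
Proof. unfold harmonic. rewrite sum_n_Sm by lia. reflexivity. Qed.

Lemma ln_succ_bounds (n : nat) :
  (0 < n)%nat -> / INR (S n) <= ln (INR (S n)) - ln (INR n) <= / INR n.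
Proof.
  intros Hn. assert (Hn0 : 0 < INR n) by (apply lt_0_INR, Hn).
  rewrite S_INR. split.
  - pose proof (ln_le_sub_1 (INR n / (INR n + 1)) ltac:(apply Rdiv_lt_0_compat; lra)) as H.
    rewrite ln_div in H by lra.
    replace (INR n / (INR n + 1) - 1) with (- / (INR n + 1)) in H by (field; lra). lra.
  - pose proof (ln_le_sub_1 ((INR n + 1) / INR n) ltac:(apply Rdiv_lt_0_compat; lra)) as H.
    rewrite ln_div in H by lra.
    replace ((INR n + 1) / INR n - 1) with (/ INR n) in H by (field; lra). lra.
Qed.

(** [harmonic n - ln n] decreases, and stays nonnegative since each
    step of [ln] is at most the preceding term of the harmonic sum.  The first
    term is dropped, [ln 0] being a default value. *)
Lemma euler_gamma_is_lim :
  is_lim_seq (fun n => harmonic n - ln (INR n)) euler_gamma.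
Proof.
  apply (Lim_seq_correct' (fun n => harmonic n - ln (INR n))).
  assert (Hex : ex_finite_lim_seq (fun n => harmonic (S n) - ln (INR (S n))));
    [apply ex_finite_lim_seq_decr with (M := 0)|].
  - intros n. rewrite (harmonic_S (S n)).
    pose proof (ln_succ_bounds (S n) ltac:(lia)). lra.
  - intros n.
    assert (Hstep : ln (INR (S n)) <= harmonic (S n) - / INR (S n)).
    { induction n as [|n IH].
      - rewrite harmonic_S, harmonic_0. simpl. rewrite Rinv_1, ln_1. lra.
      - rewrite (harmonic_S (S n)). pose proof (ln_succ_bounds (S n) ltac:(lia)). lra. }
    pose proof (Rinv_0_lt_compat (INR (S n)) ltac:(apply lt_0_INR; lia)). lra.
  - destruct Hex as [l Hl]. exists l.
    apply (is_lim_seq_incr_1 (fun n => harmonic n - ln (INR n))), Hl.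
Qed.

(** * The derivative of 1/Gamma at 1 *)

Lemma pochhammer_pos (y : R) (n : nat) : 0 < y -> 0 < pochhammer y n.
Proof.
  intros Hy. induction n as [|n IH]; simpl; [lra|].
  apply Rmult_lt_0_compat; [exact IH|]. pose proof (pos_INR n). lra.
Qed.

Lemma pochhammer_1 (n : nat) : pochhammer 1 n = INR (fact n).
Proof.
  induction n as [|n IH]; [reflexivity|].
  simpl pochhammer. rewrite IH, fact_simpl, mult_INR, S_INR. ring.
Qed.

Lemma Euler_integral_add_nat (y : R) (n : nat) :
  0 < y -> Euler_integral (y + INR n) = pochhammer y n * Euler_integral y.
Proof.
  intros Hy. induction n as [|n IH]; simpl pochhammer.
  - rewrite Rplus_0_r. ring.
  - rewrite S_INR, <- Rplus_assoc, Euler_integral_succ, IH;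
      [ring | pose proof (pos_INR n); lra].
Qed.

(** The upper bound is [Gamma(y+p) <= y^p Gamma(y)].  The lower one is the same
    inequality for the step [1-p] from [y-1+p] to [y], after
    [Gamma(y+p) = (y-1+p) Gamma(y-1+p)]. *)
Lemma ln_Euler_integral_increment (y p : R) :
  1 < y -> 0 <= p <= 1 ->
  p * ln (y - 1 + p) <= ln (Euler_integral (y + p)) - ln (Euler_integral y) <= p * ln y.
Proof.
  intros Hy Hp.
  pose proof (Euler_integral_pos y ltac:(lra)) as Gy.
  pose proof (Euler_integral_pos (y + p) ltac:(lra)) as Gyp.
  pose proof (Euler_integral_pos (y - 1 + p) ltac:(lra)) as Gz.
  split.
  - pose proof (Euler_integral_add_le (y - 1 + p) (1 - p) ltac:(lra) ltac:(lra)) as H.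
    replace (y - 1 + p + (1 - p)) with y in H by ring.
    apply ln_le in H; [|exact Gy].
    rewrite ln_mult in H by (try exact Gz; apply exp_pos).
    unfold Rpower in H. rewrite ln_exp in H.
    replace (y + p) with (y - 1 + p + 1) by ring.
    rewrite Euler_integral_succ, ln_mult by (try exact Gz; lra).
    lra.
  - pose proof (Euler_integral_add_le y p ltac:(lra) Hp) as H.
    apply ln_le in H; [|exact Gyp].
    rewrite ln_mult in H by (try exact Gy; apply exp_pos).
    unfold Rpower in H. rewrite ln_exp in H. lra.
Qed.

(** For both signs of [s] the slope lies between [ln m] and [ln (m+1)]; for
    [s < 0] the increment is read from [m+1+s] to [m+1].  The bound is uniform
    in [s], which lets [s] tend to 0 before [m] tends to infinity. *)
Lemma ln_Euler_integral_slope (m : nat) (s : R) :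
  (0 < m)%nat -> -1 < s < 1 ->
  Rabs (ln (Euler_integral (INR m + 1 + s)) - ln (Euler_integral (INR m + 1))
        - s * ln (INR m)) <= Rabs s * / INR m.
Proof.
  intros Hm Hs.
  assert (Hm1 : 1 <= INR m) by (apply (le_INR 1); lia).
  pose proof (ln_succ_bounds m Hm) as [_ Hln]. rewrite S_INR in Hln.
  destruct (Rle_lt_dec 0 s) as [H0|H0].
  - pose proof (ln_Euler_integral_increment (INR m + 1) s ltac:(lra) ltac:(lra)) as [Hlo Hhi].
    replace (INR m + 1 - 1 + s) with (INR m + s) in Hlo by ring.
    pose proof (ln_le (INR m) (INR m + s) ltac:(lra) ltac:(lra)).
    rewrite (Rabs_pos_eq s) by lra.
    apply Rabs_le. split; [|nra].
    pose proof (Rinv_0_lt_compat (INR m) ltac:(lra)). nra.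
  - pose proof (ln_Euler_integral_increment (INR m + 1 + s) (- s) ltac:(lra) ltac:(lra)) as [Hlo Hhi].
    replace (INR m + 1 + s + - s) with (INR m + 1) in Hlo, Hhi by ring.
    replace (INR m + 1 + s - 1 + - s) with (INR m) in Hlo by ring.
    pose proof (ln_le (INR m + 1 + s) (INR m + 1) ltac:(lra) ltac:(lra)).
    rewrite (Rabs_left s) by lra.
    apply Rabs_le. split; [nra|].
    pose proof (Rinv_0_lt_compat (INR m) ltac:(lra)). nra.
Qed.

Lemma is_derive_ln_pochhammer (n : nat) :
  is_derive (fun s => ln (pochhammer (1 + s) n)) 0 (harmonic n).
Proof.
  induction n as [|n IH].
  - rewrite harmonic_0. exact (is_derive_const (ln 1) 0).
  - rewrite harmonic_S.
    apply is_derive_ext_loc with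
      (f := fun s => ln (pochhammer (1 + s) n) + ln (1 + s + INR n)).
    + exists (mkposreal 1 Rlt_0_1). intros s Hs.
      change (Rabs (s - 0) < 1) in Hs. apply Rabs_def2 in Hs. pose proof (pos_INR n).
      simpl pochhammer. rewrite ln_mult; [reflexivity | apply pochhammer_pos; lra | lra].
    + apply (is_derive_plus (fun s => ln (pochhammer (1 + s) n))
               (fun s => ln (1 + s + INR n))); [exact IH|].
      rewrite S_INR. pose proof (pos_INR n).
      auto_derive; [lra | field; lra].
Qed.

(** The difference quotient plus [euler_gamma] is a sum of three small terms:
    the slope of [ln Gamma] at [m+1] minus [ln m], the slope of
    [ln (1+s)_m] minus [harmonic m], and [harmonic m - ln m - euler_gamma].
    The first and the third are made small by the choice of [m], the second
    then by that of [s]. *)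
Lemma is_derive_ln_Euler_integral_1 :
  is_derive (fun s => ln (Euler_integral (1 + s))) 0 (- euler_gamma).
Proof.
  apply is_derive_Reals. intros eps Heps.
  assert (Hm : exists m, (0 < m)%nat /\ / INR m < eps / 3 /\
     Rabs (harmonic m - ln (INR m) - euler_gamma) < eps / 3).
  { assert (H1 : eventually (fun m => Rabs (harmonic m - ln (INR m) - euler_gamma) < eps / 3)).
    { pose proof euler_gamma_is_lim as H. apply is_lim_seq_spec in H.
      exact (H (mkposreal (eps / 3) ltac:(lra))). }
    destruct H1 as [N1 H1]. destruct (archimed_cor1 (eps / 3) ltac:(lra)) as [N2 [H2 H2']].
    exists (N1 + N2)%nat. split; [lia|]. split.
    - apply Rle_lt_trans with (2 := H2). apply Rinv_le_contravar; [apply lt_0_INR, H2'|].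
      apply le_INR. lia.
    - apply H1. lia. }
  destruct Hm as [m [Hm [Hinv Hgam]]].
  pose proof (is_derive_ln_pochhammer m) as Hp. apply is_derive_Reals in Hp.
  destruct (Hp (eps / 3) ltac:(lra)) as [d Hd].
  assert (Hmin : 0 < Rmin d 1) by (apply Rmin_glb_lt; [apply cond_pos|lra]).
  exists (mkposreal _ Hmin). intros s Hs0 Hs. simpl in Hs.
  specialize (Hd s Hs0 (Rlt_le_trans _ _ _ Hs (Rmin_l _ _))).
  assert (Hs1 : -1 < s < 1)
    by (apply Rabs_def2 in Hs; pose proof (Rmin_r d 1); lra).
  pose proof (ln_Euler_integral_slope m s Hm Hs1) as Hslope.
  replace (INR m + 1 + s) with (1 + s + INR m) in Hslope by ring.
  rewrite (Rplus_comm (INR m) 1), !Euler_integral_add_nat in Hslope by lra.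
  rewrite Euler_integral_1, Rmult_1_r, ln_mult in Hslope;
    [|apply pochhammer_pos; lra | apply Euler_integral_pos; lra].
  rewrite Rplus_0_l in *. rewrite Rplus_0_r in *. rewrite Euler_integral_1, ln_1.
  set (G := ln (Euler_integral (1 + s))) in *.
  set (A := ln (pochhammer (1 + s) m)) in *. set (B := ln (pochhammer 1 m)) in *.
  replace ((G - 0) / s - - euler_gamma) with
    ((A + G - B - s * ln (INR m)) / s - ((A - B) / s - harmonic m)
     - (harmonic m - ln (INR m) - euler_gamma)) by (field; exact Hs0).
  assert (Hq : Rabs ((A + G - B - s * ln (INR m)) / s) < eps / 3).
  { unfold Rdiv at 1. rewrite Rabs_mult, Rabs_inv.
    pose proof (Rabs_pos_lt s Hs0).
    apply Rle_lt_trans with (2 := Hinv).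
    apply (Rmult_le_reg_l (Rabs s)); [assumption|].
    replace (Rabs s * (Rabs (A + G - B - s * ln (INR m)) * / Rabs s))
      with (Rabs (A + G - B - s * ln (INR m))) by (field; lra).
    exact Hslope. }
  apply Rabs_def2 in Hq. apply Rabs_def2 in Hd. apply Rabs_def2 in Hgam.
  apply Rabs_def1; lra.
Qed.

Lemma rGamma_of_pos (y : R) : 0 < y -> rGamma y = / Euler_integral y.
Proof.
  intros Hy. unfold rGamma.
  assert (H0 : gamma_shift y = 0%nat).
  { unfold gamma_shift. destruct (archimed (- y)) as [_ Hup].
    assert (IZR (up (- y)) < 1) by lra. apply lt_IZR in H. lia. }
  rewrite H0. simpl. rewrite Rplus_0_r. apply Rmult_1_l.
Qed.

Lemma is_derive_rGamma_1 : is_derive (fun b => rGamma (1 + b)) 0 euler_gamma.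
Proof.
  apply is_derive_ext_loc with (f := fun b => exp (- ln (Euler_integral (1 + b)))).
  - exists (mkposreal 1 Rlt_0_1). intros b Hb.
    change (Rabs (b - 0) < 1) in Hb. apply Rabs_def2 in Hb.
    rewrite rGamma_of_pos, exp_Ropp, exp_ln; [reflexivity | | lra].
    apply Euler_integral_pos; lra.
  - replace euler_gamma with (scal (- - euler_gamma) (exp (- ln (Euler_integral (1 + 0))))).
    + apply (is_derive_comp exp (fun b => - ln (Euler_integral (1 + b)))).
      * apply is_derive_exp.
      * apply (is_derive_opp (fun b => ln (Euler_integral (1 + b)))).
        apply is_derive_ln_Euler_integral_1.
    + rewrite Rplus_0_r, Euler_integral_1, ln_1, Ropp_0, exp_0.
      unfold scal; simpl; unfold mult; simpl. ring.
Qed.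

(** All of the dependence on [n] is moved into a rational function of [y]; this
    is what replaces a study of Gamma and digamma at every positive integer. *)
Lemma rGamma_add_nat (y : R) (n : nat) :
  0 < y -> rGamma (y + INR n) = rGamma y * / pochhammer y n.
Proof.
  intros Hy. pose proof (pos_INR n).
  rewrite !rGamma_of_pos, Euler_integral_add_nat, Rinv_mult by lra. ring.
Qed.

(** * Term-by-term differentiation *)

(** First-order expansion at 0 with an explicit remainder on [[-1/2, 1/2]].  One
    constant bounds the remainder and both coefficients, so that the notion is
    stable under products with an explicit constant. *)
Definition quadratic_expansion (f : R -> R) (f0 f1 A : R) : Prop :=
  Rabs f0 <= A /\ Rabs f1 <= A /\
  forall b, Rabs b <= 1 / 2 -> Rabs (f b - f0 - b * f1) <= A * b ^ 2.

Lemma quadratic_expansion_bound (f : R -> R) (f0 f1 A : R) :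
  quadratic_expansion f f0 f1 A ->
  forall b, Rabs b <= 1 / 2 -> Rabs (f b) <= 2 * A.
Proof.
  intros [H0 [H1 H]] b Hb. specialize (H b Hb).
  replace (f b) with ((f b - f0 - b * f1) + (f0 + b * f1)) by ring.
  eapply Rle_trans; [apply Rabs_triang|].
  pose proof (Rabs_triang f0 (b * f1)) as Htri. rewrite Rabs_mult in Htri.
  rewrite <- pow2_abs in H.
  pose proof (Rabs_pos b). pose proof (Rabs_pos f0). pose proof (Rabs_pos f1).
  assert (Rabs b * Rabs f1 <= 1 / 2 * A) by nra.
  assert (A * Rabs b ^ 2 <= A * (1 / 4)) by (apply Rmult_le_compat_l; nra).
  lra.
Qed.

Lemma quadratic_expansion_0 (f : R -> R) (f0 f1 A : R) :
  quadratic_expansion f f0 f1 A -> f 0 = f0.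
Proof.
  intros [_ [_ H]]. specialize (H 0 ltac:(rewrite Rabs_R0; lra)).
  replace (A * 0 ^ 2) with 0 in H by ring.
  pose proof (Rabs_pos (f 0 - f0 - 0 * f1)).
  assert (Habs : Rabs (f 0 - f0 - 0 * f1) = 0) by lra.
  apply Rabs_eq_0 in Habs. lra.
Qed.

Lemma quadratic_expansion_mult (f g : R -> R) (f0 f1 g0 g1 A B : R) :
  quadratic_expansion f f0 f1 A -> quadratic_expansion g g0 g1 B ->
  quadratic_expansion (fun b => f b * g b) (f0 * g0) (f0 * g1 + f1 * g0) (5 * (A * B)).
Proof.
  intros Hf Hg. pose proof (quadratic_expansion_bound _ _ _ _ Hg) as Bg.
  destruct Hf as [F0 [F1 Hf]], Hg as [G0 [G1 Hg]].
  pose proof (Rabs_pos f0). pose proof (Rabs_pos f1).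
  pose proof (Rabs_pos g0). pose proof (Rabs_pos g1).
  assert (Hprod : forall u v, Rabs u <= A -> Rabs v <= B -> Rabs (u * v) <= A * B).
  { intros u v Hu Hv. rewrite Rabs_mult.
    apply Rmult_le_compat; try assumption; apply Rabs_pos. }
  assert (0 <= A * B) by (apply Rmult_le_pos; lra).
  split; [|split].
  - pose proof (Hprod f0 g0 F0 G0). lra.
  - eapply Rle_trans; [apply Rabs_triang|].
    pose proof (Hprod f0 g1 F0 G1). pose proof (Hprod f1 g0 F1 G0). lra.
  - intros b Hb. specialize (Hf b Hb). specialize (Hg b Hb). specialize (Bg b Hb).
    replace (f b * g b - f0 * g0 - b * (f0 * g1 + f1 * g0)) with
      ((f b - f0 - b * f1) * g b + (f0 + b * f1) * (g b - g0 - b * g1)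
       + b ^ 2 * (f1 * g1)) by ring.
    eapply Rle_trans; [apply Rabs_triang|].
    rewrite (Rabs_mult (b ^ 2)), (Rabs_pos_eq (b ^ 2)) by apply pow2_ge_0.
    pose proof (pow2_ge_0 b).
    assert (T3 : b ^ 2 * Rabs (f1 * g1) <= b ^ 2 * (A * B))
      by (apply Rmult_le_compat_l; auto).
    assert (T1 : Rabs ((f b - f0 - b * f1) * g b) <= (A * b ^ 2) * (2 * B)).
    { rewrite Rabs_mult. apply Rmult_le_compat; try assumption; apply Rabs_pos. }
    assert (T2 : Rabs ((f0 + b * f1) * (g b - g0 - b * g1)) <= (2 * A) * (B * b ^ 2)).
    { rewrite Rabs_mult. apply Rmult_le_compat; try assumption; try apply Rabs_pos.
      eapply Rle_trans; [apply Rabs_triang|]. rewrite Rabs_mult.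
      pose proof (Rabs_pos b). nra. }
    pose proof (Rabs_triang ((f b - f0 - b * f1) * g b)
      ((f0 + b * f1) * (g b - g0 - b * g1))). nra.
Qed.

Lemma is_derive_of_quadratic_remainder (F : R -> R) (D K : R) :
  (forall b, Rabs b <= 1 / 2 -> Rabs (F b - F 0 - b * D) <= K * b ^ 2) ->
  is_derive F 0 D.
Proof.
  intros HF.
  assert (HK : 0 <= K).
  { specialize (HF (1 / 2) ltac:(rewrite Rabs_pos_eq; lra)).
    pose proof (Rabs_pos (F (1 / 2) - F 0 - 1 / 2 * D)). lra. }
  apply is_derive_Reals. intros eps Heps.
  assert (Hd : 0 < Rmin (1 / 2) (eps / (K + 1)))
    by (apply Rmin_glb_lt; [lra | apply Rdiv_lt_0_compat; lra]).
  exists (mkposreal _ Hd). intros h Hh0 Hh. simpl in Hh. rewrite Rplus_0_l.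
  pose proof (Rmin_l (1 / 2) (eps / (K + 1))). pose proof (Rmin_r (1 / 2) (eps / (K + 1))).
  specialize (HF h ltac:(lra)).
  pose proof (Rabs_pos_lt h Hh0) as Hpos.
  replace ((F h - F 0) / h - D) with ((F h - F 0 - h * D) / h) by (field; exact Hh0).
  unfold Rdiv. rewrite Rabs_mult, Rabs_inv.
  apply (Rmult_lt_reg_r (Rabs h)); [exact Hpos|].
  rewrite Rmult_assoc, Rinv_l, Rmult_1_r by lra.
  rewrite <- pow2_abs in HF.
  assert (Hlt : Rabs h * (K + 1) < eps).
  { apply (Rmult_lt_reg_r (/ (K + 1))); [apply Rinv_0_lt_compat; lra|].
    rewrite Rmult_assoc, Rinv_r by lra. unfold Rdiv in *. lra. }
  nra.
Qed.

(** A summable family of quadratic remainders adds up to a quadratic remainder,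
    so no uniform convergence of derivatives has to be discussed. *)
Lemma is_derive_Series_quadratic (c f0 f1 M : nat -> R) (f : nat -> R -> R) :
  (forall n, quadratic_expansion (f n) (f0 n) (f1 n) (M n)) ->
  ex_series (fun n => Rabs (c n) * M n) ->
  (forall b, Rabs b <= 1 / 2 -> ex_series (fun n => c n * f n b)) /\
  ex_series (fun n => c n * f1 n) /\
  is_derive (fun b => Series (fun n => c n * f n b)) 0 (Series (fun n => c n * f1 n)).
Proof.
  intros Hf HM.
  assert (Ef : forall b, Rabs b <= 1 / 2 -> ex_series (fun n => c n * f n b)).
  { intros b Hb.
    apply (@ex_series_le R_AbsRing R_CompleteNormedModule) with
      (b := fun n => Rabs (c n) * M n * 2); [|apply ex_series_scal_r, HM].
    intros n. change (Rabs (c n * f n b) <= Rabs (c n) * M n * 2).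
    rewrite Rabs_mult, Rmult_assoc. apply Rmult_le_compat_l; [apply Rabs_pos|].
    rewrite Rmult_comm. exact (quadratic_expansion_bound _ _ _ _ (Hf n) b Hb). }
  assert (E1 : ex_series (fun n => c n * f1 n)).
  { apply (@ex_series_le R_AbsRing R_CompleteNormedModule) with
      (b := fun n => Rabs (c n) * M n); [|exact HM].
    intros n. change (Rabs (c n * f1 n) <= Rabs (c n) * M n).
    rewrite Rabs_mult. apply Rmult_le_compat_l; [apply Rabs_pos|]. apply Hf. }
  split; [exact Ef|]. split; [exact E1|].
  assert (Z0 : Rabs 0 <= 1 / 2) by (rewrite Rabs_R0; lra).
  apply (is_derive_of_quadratic_remainder _ _ (Series (fun n => Rabs (c n) * M n))).
  intros b Hb.
  assert (Hterm : forall n,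
    0 <= Rabs (c n * f n b - c n * f n 0 - b * (c n * f1 n)) <= Rabs (c n) * M n * b ^ 2).
  { intros n. split; [apply Rabs_pos|].
    rewrite (quadratic_expansion_0 _ _ _ _ (Hf n)).
    replace (c n * f n b - c n * f0 n - b * (c n * f1 n))
      with (c n * (f n b - f0 n - b * f1 n)) by ring.
    rewrite Rabs_mult, Rmult_assoc. apply Rmult_le_compat_l; [apply Rabs_pos|].
    apply Hf, Hb. }
  rewrite <- Series_scal_l, <- Series_scal_r.
  rewrite <- Series_minus by auto.
  rewrite <- Series_minus; cycle 1.
  - apply (ex_series_minus (fun n => c n * f n b) (fun n => c n * f n 0)); auto.
  - apply (ex_series_scal b (fun n => c n * f1 n)), E1.
  - eapply Rle_trans; [apply Series_Rabs|].
    + apply (@ex_series_le R_AbsRing R_CompleteNormedModule) with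
        (b := fun n => Rabs (c n) * M n * b ^ 2); [|apply ex_series_scal_r, HM].
      intros n. change (norm (Rabs (c n * f n b - c n * f n 0 - b * (c n * f1 n))))
        with (Rabs (Rabs (c n * f n b - c n * f n 0 - b * (c n * f1 n)))).
      rewrite Rabs_Rabsolu. apply Hterm.
    + apply Series_le; [exact Hterm | apply ex_series_scal_r, HM].
Qed.

(** The derivative of [1/(1+b)_n] at [b = 0].  Since [harmonic n] is
    [psi(n+1) + euler_gamma], it carries the digamma values of the differentiated
    series. *)
Definition inv_pochhammer_slope (n : nat) : R := - harmonic n / INR (fact n).

(** The derivative at 0 of [1/(1+b)_n = (n+1+b) * 1/(1+b)_(n+1)]. *)
Lemma inv_pochhammer_slope_S (n : nat) :
  inv_pochhammer_slope n =
  INR (S n) * inv_pochhammer_slope (S n) + / INR (fact (S n)).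
Proof.
  unfold inv_pochhammer_slope. rewrite harmonic_S, fact_simpl, mult_INR.
  field. split; [apply INR_fact_neq_0 | apply not_0_INR; lia].
Qed.

(** Each factor [1/(n+1+b)] expands with constant 2, and a product costs a factor
    5; hence the [10^n]. *)
Lemma quadratic_expansion_inv_pochhammer (n : nat) :
  quadratic_expansion (fun b => / pochhammer (1 + b) n)
    (/ INR (fact n)) (inv_pochhammer_slope n) (10 ^ n).
Proof.
  induction n as [|n IH].
  - unfold inv_pochhammer_slope, quadratic_expansion. rewrite harmonic_0. simpl.
    split; [|split]; [| |intros b Hb].
    + rewrite Rinv_1, Rabs_R1. lra.
    + replace (- 0 / 1) with 0 by field. rewrite Rabs_R0. lra.
    + replace (/ 1 - / 1 - b * (- 0 / 1)) with 0 by field. rewrite Rabs_R0.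
      nra.
  - set (N := INR n + 1). pose proof (pos_INR n).
    assert (HN : 1 <= N) by (unfold N; lra).
    assert (HNi : 0 < / N <= 1).
    { split; [apply Rinv_0_lt_compat; lra|].
      rewrite <- Rinv_1. apply Rinv_le_contravar; lra. }
    assert (Hlin : quadratic_expansion (fun b => / (N + b)) (/ N) (- / N ^ 2) 2).
    { split; [|split].
      - rewrite Rabs_pos_eq; lra.
      - rewrite Rabs_Ropp, <- pow_inv, Rabs_pos_eq; [nra | apply pow2_ge_0].
      - intros b Hb. apply Rabs_le_between in Hb.
        replace (/ (N + b) - / N - b * - / N ^ 2) with (/ N ^ 2 * / (N + b) * b ^ 2)
          by (field; lra).
        pose proof (pow2_ge_0 b).
        assert (Hi : 0 < / (N + b) <= 2).
        { split; [apply Rinv_0_lt_compat; lra|].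
          replace 2 with (/ (1 / 2)) by field. apply Rinv_le_contravar; lra. }
        assert (H2 : 0 < / N ^ 2 <= 1) by (rewrite <- pow_inv; nra).
        rewrite Rabs_pos_eq by (apply Rmult_le_pos; [apply Rmult_le_pos|]; lra).
        apply Rmult_le_compat_r; [assumption|]. nra. }
    pose proof (quadratic_expansion_mult _ _ _ _ _ _ _ _ IH Hlin) as Hprod.
    replace (10 ^ S n) with (5 * (10 ^ n * 2)) by (simpl; ring).
    replace (/ INR (fact (S n))) with (/ INR (fact n) * / N);
      [replace (inv_pochhammer_slope (S n)) with
         (/ INR (fact n) * - / N ^ 2 + inv_pochhammer_slope n * / N)|].
    + destruct Hprod as [P0 [P1 P2]]. split; [exact P0|]. split; [exact P1|].
      intros b Hb. simpl pochhammer. rewrite Rinv_mult.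
      replace (1 + b + INR n) with (N + b) by (unfold N; ring). apply P2, Hb.
    + rewrite (inv_pochhammer_slope_S n), fact_simpl, mult_INR, S_INR. fold N.
      field. repeat split; (apply INR_fact_neq_0 || lra).
    + rewrite fact_simpl, mult_INR, S_INR. fold N.
      field. repeat split; (apply INR_fact_neq_0 || lra).
Qed.

Lemma is_derive_Series_inv_pochhammer (c : nat -> R) :
  ex_series (fun n => Rabs (c n) * 10 ^ n) ->
  (forall b, Rabs b <= 1 / 2 -> ex_series (fun n => c n * / pochhammer (1 + b) n)) /\
  ex_series (fun n => c n * inv_pochhammer_slope n) /\
  is_derive (fun b => Series (fun n => c n * / pochhammer (1 + b) n)) 0
    (Series (fun n => c n * inv_pochhammer_slope n)).
Proof.
  apply (is_derive_Series_quadratic c (fun n => / INR (fact n)) inv_pochhammer_slope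
    (fun n => 10 ^ n) (fun n b => / pochhammer (1 + b) n)).
  apply quadratic_expansion_inv_pochhammer.
Qed.

Lemma ex_series_exp (y : R) : ex_series (fun n => y ^ n / INR (fact n)).
Proof.
  exists (exp y). apply (is_series_ext (fun n => scal (pow_n y n) (/ INR (fact n)))).
  - intros n. rewrite pow_n_pow. reflexivity.
  - exact (is_exp_Reals y).
Qed.

(** * The series of the Bessel functions *)

Lemma locally_half : locally 0 (fun b => Rabs b <= 1 / 2).
Proof.
  assert (H : 0 < 1 / 2) by lra.
  exists (mkposreal _ H). intros b Hb. change (Rabs (b - 0) < 1 / 2) in Hb.
  rewrite Rminus_0_r in Hb. lra.
Qed.

(** The hypergeometric series [0F1(; 1+b; x)]. *)
Definition hyp0F1 (x b : R) : R :=
  Series (fun n => x ^ n / INR (fact n) * / pochhammer (1 + b) n).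

Lemma ex_series_exp_coeff (x : R) :
  ex_series (fun n => Rabs (x ^ n / INR (fact n)) * 10 ^ n).
Proof.
  apply (ex_series_ext (fun n => (10 * Rabs x) ^ n / INR (fact n))).
  - intros n. unfold Rdiv. rewrite Rabs_mult, <- RPow_abs, Rabs_inv, Rpow_mult_distr.
    rewrite (Rabs_pos_eq (INR (fact n))) by apply pos_INR.
    change ((10 ^ n * Rabs x ^ n * / INR (fact n)) =
     Rabs x ^ n * / INR (fact n) * 10 ^ n). ring.
  - apply ex_series_exp.
Qed.

(** [I_mu(2 sqrt x)] without its factor [x^(mu/2)]: an entire function of [x],
    real for real [x]. *)
Definition bessel_series (x mu : R) : R :=
  Series (fun k => x ^ k * (rGamma (mu + INR k + 1) / INR (fact k))).

Lemma bessel_series_eq (x mu : R) :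
  Rabs mu <= 1 / 2 -> bessel_series x mu = rGamma (1 + mu) * hyp0F1 x mu.
Proof.
  intros Hmu. apply Rabs_le_between in Hmu. unfold bessel_series, hyp0F1.
  rewrite <- Series_scal_l. apply Series_ext. intros k.
  replace (mu + INR k + 1) with (1 + mu + INR k) by ring.
  rewrite rGamma_add_nat by lra. unfold Rdiv. ring.
Qed.

Lemma is_derive_rGamma_mult (F : R -> R) (D : R) :
  is_derive F 0 D ->
  is_derive (fun b => rGamma (1 + b) * F b) 0 (euler_gamma * F 0 + D).
Proof.
  intros HF.
  replace (euler_gamma * F 0 + D)
    with (euler_gamma * F 0 + rGamma (1 + 0) * D).
  - apply (is_derive_mult (fun b => rGamma (1 + b)) F 0 euler_gamma D);
      [apply is_derive_rGamma_1 | exact HF | intros; apply Rmult_comm].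
  - rewrite Rplus_0_r, rGamma_of_pos, Euler_integral_1, Rinv_1 by lra. ring.
Qed.

Lemma is_derive_bessel_series (x : R) :
  is_derive (bessel_series x) 0
    (euler_gamma * hyp0F1 x 0
     + Series (fun n => x ^ n / INR (fact n) * inv_pochhammer_slope n)).
Proof.
  apply is_derive_ext_loc with (f := fun mu => rGamma (1 + mu) * hyp0F1 x mu).
  - generalize locally_half. apply filter_imp. intros mu Hmu.
    symmetry. apply bessel_series_eq, Hmu.
  - apply is_derive_rGamma_mult.
    apply (is_derive_Series_inv_pochhammer (fun n => x ^ n / INR (fact n))
             (ex_series_exp_coeff x)).
Qed.

Lemma bessel_series_0 (x : R) : bessel_series x 0 = hyp0F1 x 0.
Proof.
  rewrite bessel_series_eq by (rewrite Rabs_R0; lra).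
  rewrite Rplus_0_r, rGamma_of_pos, Euler_integral_1, Rinv_1 by lra. ring.
Qed.

(** * The integral Wright function *)

Definition Wi_coeff (x : R) (n : nat) : R := x ^ S n / (INR (S n) * INR (fact (S n))).

Lemma ex_series_Wi_coeff (x : R) : ex_series (fun n => Rabs (Wi_coeff x n) * 10 ^ n).
Proof.
  apply (@ex_series_le R_AbsRing R_CompleteNormedModule) with
    (b := fun n => Rabs (x ^ S n / INR (fact (S n))) * 10 ^ S n).
  - intros n.
    change (Rabs (Rabs (Wi_coeff x n) * 10 ^ n) <=
      Rabs (x ^ S n / INR (fact (S n))) * 10 ^ S n).
    rewrite Rabs_mult, Rabs_Rabsolu, (Rabs_pos_eq (10 ^ n)) by (apply pow_le; lra).
    apply Rmult_le_compat; [apply Rabs_pos | apply pow_le; lra | |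
      apply Rle_pow; [lra | lia]].
    unfold Wi_coeff, Rdiv. rewrite Rinv_mult, !Rabs_mult.
    apply Rmult_le_compat_l; [apply Rabs_pos|].
    rewrite <- (Rmult_1_l (Rabs (/ INR (fact (S n))))) at 2.
    apply Rmult_le_compat_r; [apply Rabs_pos|].
    assert (H : 1 <= INR (S n)) by (apply (le_INR 1); lia).
    rewrite Rabs_inv, Rabs_pos_eq by lra.
    rewrite <- Rinv_1. apply Rinv_le_contravar; lra.
  - apply (ex_series_incr_1 (fun n => Rabs (x ^ n / INR (fact n)) * 10 ^ n)).
    apply ex_series_exp_coeff.
Qed.

Lemma Wi_1_eq (x b : R) :
  Rabs b <= 1 / 2 ->
  Wi 1 b x = rGamma (1 + b) * Series (fun n => Wi_coeff x n * / pochhammer (1 + b) n).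
Proof.
  intros Hb. apply Rabs_le_between in Hb. unfold Wi. rewrite <- Series_scal_l.
  apply Series_ext. intros n. cbv zeta. fold (Wi_coeff x n).
  replace (1 * INR (S n) + b) with (1 + b + INR n) by (rewrite S_INR; ring).
  rewrite rGamma_add_nat by lra. ring.
Qed.

Lemma is_derive_Wi_1 (x : R) :
  is_derive (fun b => Wi 1 b x) 0
    (euler_gamma * Series (fun n => Wi_coeff x n * / pochhammer (1 + 0) n)
     + Series (fun n => Wi_coeff x n * inv_pochhammer_slope n)).
Proof.
  apply is_derive_ext_loc with (f := fun b => rGamma (1 + b) *
     Series (fun n => Wi_coeff x n * / pochhammer (1 + b) n)).
  - generalize locally_half. apply filter_imp. intros b Hb.
    symmetry. apply Wi_1_eq, Hb.
  - apply (is_derive_rGamma_mult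
      (fun b => Series (fun n => Wi_coeff x n * / pochhammer (1 + b) n))).
    apply (is_derive_Series_inv_pochhammer _ (ex_series_Wi_coeff x)).
Qed.

(** Both sides are [sum_(k >= 1) x^k/k!^2]; the 1 is the term [k = 0] of
    [I_0(2 sqrt x)]. *)
Lemma Wi_coeff_value (x : R) :
  Series (fun n => Wi_coeff x n * / pochhammer (1 + 0) n) = hyp0F1 x 0 - 1.
Proof.
  unfold hyp0F1. rewrite (Series_incr_1 (fun n => _ / INR (fact n) * _)).
  - simpl pochhammer. simpl fact. simpl pow. simpl (INR 1).
    rewrite (Series_ext (fun n => Wi_coeff x n * / pochhammer (1 + 0) n)
      (fun k => x ^ S k / INR (fact (S k)) * / pochhammer (1 + 0) (S k))).
    + simpl. field.
    + intros n. unfold Wi_coeff. simpl (pochhammer _ (S n)).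
      replace (1 + 0 + INR n) with (INR (S n)) by (rewrite S_INR; ring).
      field. repeat split; try apply INR_fact_neq_0; try (apply not_0_INR; lia).
      apply Rgt_not_eq, pochhammer_pos. lra.
  - apply (is_derive_Series_inv_pochhammer _ (ex_series_exp_coeff x)).
    rewrite Rabs_R0. lra.
Qed.

Lemma pochhammer_2 (n : nat) : pochhammer 2 n = INR (fact (S n)).
Proof.
  induction n as [|n IH]; [reflexivity|].
  simpl pochhammer. rewrite IH, (fact_simpl (S n)), mult_INR, !S_INR. ring.
Qed.

(** By [inv_pochhammer_slope_S], the term [n] on the left is the term [n+1] of
    the Bessel sum plus [x^(n+1)/((n+1) (n+1)!^2)], and the latter is [x] times
    the term [n] of the hypergeometric series, as [(1)_n = n!] and
    [(2)_n = (n+1)!].  The term 0 of the Bessel sum vanishes. *)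
Lemma Wi_coeff_slope (x : R) :
  Series (fun n => Wi_coeff x n * inv_pochhammer_slope n) =
  Series (fun n => x ^ n / INR (fact n) * inv_pochhammer_slope n)
  + x * pFq [1; 1] [2; 2; 2] x.
Proof.
  assert (Et : ex_series (fun n => x ^ n / INR (fact n) * inv_pochhammer_slope n))
    by apply (is_derive_Series_inv_pochhammer _ (ex_series_exp_coeff x)).
  assert (Ew : ex_series (fun n => Wi_coeff x n * inv_pochhammer_slope n))
    by apply (is_derive_Series_inv_pochhammer _ (ex_series_Wi_coeff x)).
  rewrite (Series_incr_1 _ Et).
  apply ex_series_incr_1 in Et.
  replace (x ^ 0 / INR (fact 0) * inv_pochhammer_slope 0) with 0
    by (unfold inv_pochhammer_slope; rewrite harmonic_0; simpl; field).
  rewrite Rplus_0_l. unfold pFq. rewrite <- Series_scal_l.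
  apply (Rplus_eq_reg_l (- Series (fun k => x ^ S k / INR (fact (S k)) * inv_pochhammer_slope (S k)))).
  rewrite Rplus_comm, <- Rplus_assoc, Rplus_opp_l, Rplus_0_l.
  fold (Rminus (Series (fun n => Wi_coeff x n * inv_pochhammer_slope n))
     (Series (fun k => x ^ S k / INR (fact (S k)) * inv_pochhammer_slope (S k)))).
  rewrite <- Series_minus by assumption.
  apply Series_ext. intros n. unfold pochhammer_prod, Wi_coeff.
  simpl map. simpl fold_right. rewrite pochhammer_1, pochhammer_2.
  rewrite (inv_pochhammer_slope_S n), (fact_simpl n), mult_INR. simpl pow.
  field. split; [apply INR_fact_neq_0 | apply not_0_INR; lia].
Qed.

(** * Principal branches and the Bessel functions *)

(** The upper half of the principal strip is enough below: the argument of a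
    real number is 0 or [PI], so that of its square root is 0 or [PI/2]. *)
Lemma Clog_Cexp (w : C) : 0 <= Im w <= PI -> Clog (Cexp w) = w.
Proof.
  intros Hw. destruct w as [r t]. unfold Im in Hw; simpl in Hw.
  assert (Hmod : Cmod (Cexp (r, t)) = exp r).
  { unfold Cmod, Cexp, Re, Im; simpl.
    transitivity (sqrt (Rsqr (exp r))); [f_equal | apply sqrt_Rsqr; left; apply exp_pos].
    pose proof (sin2_cos2 t) as H. unfold Rsqr in *.
    transitivity (exp r * exp r * (sin t * sin t + cos t * cos t)); [ring|].
    rewrite H. ring. }
  unfold Clog, Carg. rewrite Hmod, ln_exp. f_equal.
  unfold Cexp, Re, Im; simpl.
  pose proof (sin_ge_0 t ltac:(lra) ltac:(lra)). pose proof (exp_pos r).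
  destruct (Rle_dec 0 (exp r * sin t)) as [_|Hn].
  - replace (exp r * cos t / exp r) with (cos t) by (field; lra).
    apply acos_cos. exact Hw.
  - exfalso. apply Hn, Rmult_le_pos; lra.
Qed.

Lemma Cexp_plus (w v : C) : Cexp (w + v) = (Cexp w * Cexp v)%C.
Proof.
  unfold Cexp, Cmult, Cplus, Re, Im; simpl.
  rewrite exp_plus, cos_plus, sin_plus. f_equal; ring.
Qed.

Lemma Carg_RtoC_pos (x : R) : 0 < x -> Carg (RtoC x) = 0.
Proof.
  intros Hx. unfold Carg, Re, Im. simpl. rewrite Cmod_R, Rabs_pos_eq by lra.
  destruct (Rle_dec 0 0) as [_|Hn]; [|lra].
  unfold Rdiv. rewrite Rinv_r by lra. apply acos_1.
Qed.

Lemma Carg_RtoC_neg (x : R) : x < 0 -> Carg (RtoC x) = PI.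
Proof.
  intros Hx. unfold Carg, Re, Im. simpl. rewrite Cmod_R, Rabs_left by lra.
  destruct (Rle_dec 0 0) as [_|Hn]; [|lra].
  replace (x / - x) with (- (1)) by (field; lra).
  rewrite acos_opp, acos_1. ring.
Qed.

Lemma Carg_RtoC_bound (x : R) : x <> 0 -> 0 <= Carg (RtoC x) <= PI.
Proof.
  intros Hx. pose proof PI_RGT_0.
  destruct (Rtotal_order x 0) as [Hn|[H0|Hp]]; [|contradiction|].
  - rewrite Carg_RtoC_neg; lra.
  - rewrite Carg_RtoC_pos; lra.
Qed.

Lemma Cexp_Clog_RtoC (x : R) : x <> 0 -> Cexp (Clog (RtoC x)) = RtoC x.
Proof.
  intros Hx. unfold Clog. rewrite Cmod_R.
  destruct (Rtotal_order x 0) as [Hn|[H0|Hp]]; [|contradiction|].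
  - rewrite Carg_RtoC_neg, Rabs_left by lra. unfold Cexp, Re, Im, RtoC; simpl.
    rewrite cos_PI, sin_PI, exp_ln by lra. f_equal; ring.
  - rewrite Carg_RtoC_pos, Rabs_pos_eq by lra. unfold Cexp, Re, Im, RtoC; simpl.
    rewrite cos_0, sin_0, exp_ln by lra. f_equal; ring.
Qed.

Lemma Csqrt_sqr_RtoC (x : R) :
  x <> 0 -> (Csqrt (RtoC x) * Csqrt (RtoC x) = RtoC x)%C.
Proof.
  intros Hx. unfold Csqrt, Cpower. rewrite <- Cexp_plus.
  rewrite <- (Cexp_Clog_RtoC x Hx) at 3. f_equal.
  rewrite <- Cmult_plus_distr_r, <- RtoC_plus.
  replace (/ 2 + / 2) with 1 by field. apply Cmult_1_l.
Qed.

(** Halving the argument stays inside the principal strip, so the powers compose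
    without a jump of branch, also for [x < 0]. *)
Lemma Cpower_Csqrt_RtoC (x s : R) :
  x <> 0 -> Cpower (Csqrt (RtoC x)) s = Cexp (RtoC (s / 2) * Clog (RtoC x))%C.
Proof.
  intros Hx. unfold Cpower at 1, Csqrt, Cpower. rewrite Clog_Cexp.
  - f_equal. rewrite Cmult_assoc, <- RtoC_mult. reflexivity.
  - pose proof (Carg_RtoC_bound x Hx). unfold Im, Clog, Cmult, RtoC; simpl.
    fold (RtoC x). lra.
Qed.

Lemma CSeries_of_real (a : nat -> C) (b : nat -> R) :
  (forall n, a n = RtoC (b n)) -> CSeries a = RtoC (Series b).
Proof.
  intros H. unfold CSeries, RtoC. f_equal.
  - apply Series_ext. intros n. rewrite H. reflexivity.
  - rewrite <- (Rmult_0_l (Series (fun _ => 0))), <- Series_scal_l.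
    apply Series_ext. intros n. rewrite H. simpl. ring.
Qed.

Lemma BesselI_2_Csqrt (x mu : R) :
  x <> 0 ->
  BesselI mu (RtoC 2 * Csqrt (RtoC x))%C =
  (Cexp (RtoC (mu / 2) * Clog (RtoC x)) * RtoC (bessel_series x mu))%C.
Proof.
  intros Hx. unfold BesselI.
  assert (H2 : RtoC 2 <> 0%C) by (intros H; apply RtoC_inj in H; lra).
  replace (RtoC 2 * Csqrt (RtoC x) / RtoC 2)%C with (Csqrt (RtoC x))
    by (field; exact H2).
  rewrite Cpower_Csqrt_RtoC by exact Hx. f_equal.
  assert (Hsq : (RtoC 2 * Csqrt (RtoC x) * (RtoC 2 * Csqrt (RtoC x)) / RtoC 4)%C = RtoC x).
  { rewrite <- (Csqrt_sqr_RtoC x Hx) at 3.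
    replace (RtoC 4) with (RtoC 2 * RtoC 2)%C by (rewrite <- RtoC_mult; f_equal; ring).
    field. }
  rewrite Hsq. apply CSeries_of_real. intros k.
  rewrite <- RtoC_pow, <- RtoC_mult. reflexivity.
Qed.

Lemma is_lim_difference_quotient_0 (g : R -> R) (d : R) :
  is_derive g 0 d -> g 0 = 0 -> is_lim (fun h => g h / h) 0 d.
Proof.
  intros Hg Hg0. apply is_lim_spec. intros eps.
  apply is_derive_Reals in Hg. destruct (Hg eps (cond_pos eps)) as [del Hdel].
  exists del. intros h Hh Hh0.
  change (Rabs (h - 0) < del) in Hh. rewrite Rminus_0_r in Hh.
  specialize (Hdel h Hh0 Hh). rewrite Rplus_0_l, Hg0, Rminus_0_r in Hdel. exact Hdel.
Qed.

Lemma sin_PI_neq_0_near_0 : Rbar_locally' 0 (fun mu => sin (mu * PI) <> 0).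
Proof.
  pose proof PI_RGT_0.
  exists (mkposreal 1 Rlt_0_1). intros mu Hmu Hmu0.
  change (Rabs (mu - 0) < 1) in Hmu. apply Rabs_def2 in Hmu.
  destruct (Rtotal_order mu 0) as [Hn|[H0|Hp]]; [|contradiction|].
  - replace (mu * PI) with (- (- mu * PI)) by ring. rewrite sin_neg.
    apply Ropp_neq_0_compat, Rgt_not_eq, sin_gt_0; nra.
  - apply Rgt_not_eq, sin_gt_0; nra.
Qed.

(** The limit form of [K]: numerator and denominator vanish at 0 to first order,
    with derivatives [- PI d] and [PI]. *)
Lemma is_lim_reflection_quotient (f : R -> R) (d : R) :
  is_derive f 0 d ->
  is_lim (fun mu => PI / 2 * (f (- mu) - f mu) / sin (mu * PI)) 0 (- d).
Proof.
  intros Hf. pose proof PI_RGT_0.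
  assert (Hnum : is_lim (fun mu => (PI / 2 * (f (- mu) - f mu)) / mu) 0 (- (PI * d))).
  { apply is_lim_difference_quotient_0; [|rewrite Ropp_0; ring].
    replace (- (PI * d)) with (PI / 2 * (- d - d)) by field.
    apply (is_derive_scal (fun mu => f (- mu) - f mu)).
    apply (is_derive_minus (fun mu => f (- mu)) f); [|exact Hf].
    replace (- d) with (scal (-1) d) by (unfold scal; simpl; unfold mult; simpl; ring).
    apply (is_derive_comp f Ropp); [rewrite Ropp_0; exact Hf|].
    auto_derive; [trivial|ring]. }
  assert (Hden : is_lim (fun mu => sin (mu * PI) / mu) 0 PI).
  { apply is_lim_difference_quotient_0; [|rewrite Rmult_0_l; apply sin_0].
    auto_derive; [trivial|]. rewrite Rmult_0_l, cos_0. ring. }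
  apply is_lim_ext_loc with
    (f := fun mu => (PI / 2 * (f (- mu) - f mu) / mu) / (sin (mu * PI) / mu)).
  - destruct sin_PI_neq_0_near_0 as [eps Heps]. exists eps. intros mu Hmu Hmu0.
    field. split; [exact (Heps mu Hmu Hmu0) | exact Hmu0].
  - replace (Finite (- d)) with (Rbar_div (- (PI * d)) PI)
      by (simpl; f_equal; field; lra).
    apply is_lim_div; [exact Hnum | exact Hden | |reflexivity].
    intros H0. injection H0. lra.
Qed.

Lemma BesselI_0_2_Csqrt (x : R) :
  x <> 0 -> BesselI 0 (RtoC 2 * Csqrt (RtoC x))%C = RtoC (bessel_series x 0).
Proof.
  intros Hx. rewrite BesselI_2_Csqrt by exact Hx.
  unfold Cexp, Cmult, RtoC, Re, Im, Clog; simpl.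
  replace (0 / 2) with 0 by field. rewrite !Rmult_0_l.
  rewrite Rminus_0_r, Rplus_0_r, exp_0, cos_0, sin_0. f_equal; ring.
Qed.

(** With [l + i th = Clog x / 2], the real and the imaginary part of
    [I_mu(2 sqrt x)] are [exp(mu l) cos(mu th)] and [exp(mu l) sin(mu th)] times
    [bessel_series x mu].  These have derivatives [l] and [th] and values 1 and 0
    at 0, so the product rule and the limit form of [K] give both parts of
    [K_0]. *)
Lemma BesselK_0_2_Csqrt (x D : R) :
  x <> 0 -> is_derive (bessel_series x) 0 D ->
  BesselK 0 (RtoC 2 * Csqrt (RtoC x))%C =
  (- (RtoC (1 / 2) * Clog (RtoC x) * RtoC (bessel_series x 0)) - RtoC D)%C.
Proof.
  intros Hx HD. unfold BesselK.
  destruct (Req_dec_T (sin (0 * PI)) 0) as [_|Hn];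
    [|exfalso; apply Hn; rewrite Rmult_0_l; apply sin_0].
  set (l := ln (Rabs x) / 2). set (th := Carg (RtoC x) / 2).
  assert (HI : forall mu, BesselI mu (RtoC 2 * Csqrt (RtoC x))%C =
    (exp (mu * l) * cos (mu * th) * bessel_series x mu,
     exp (mu * l) * sin (mu * th) * bessel_series x mu)).
  { intros mu. rewrite BesselI_2_Csqrt by exact Hx.
    unfold Cexp, Clog. rewrite Cmod_R.
    replace (RtoC (mu / 2) * (ln (Rabs x), Carg (RtoC x)))%C with (mu * l, mu * th)
      by (unfold l, th, Cmult, RtoC; simpl; fold (RtoC x); f_equal; field).
    unfold Cmult, RtoC, Re, Im; simpl. f_equal; ring. }
  assert (Hq : forall mu, sin (mu * PI) <> 0 ->
    BesselK_quotient mu (RtoC 2 * Csqrt (RtoC x)) =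
    (PI / 2 * (exp (- mu * l) * cos (- mu * th) * bessel_series x (- mu) -
               exp (mu * l) * cos (mu * th) * bessel_series x mu) / sin (mu * PI),
     PI / 2 * (exp (- mu * l) * sin (- mu * th) * bessel_series x (- mu) -
               exp (mu * l) * sin (mu * th) * bessel_series x mu) / sin (mu * PI))).
  { intros mu Hmu. unfold BesselK_quotient. rewrite !HI. unfold Cdiv.
    rewrite <- RtoC_inv by exact Hmu.
    apply injective_projections; simpl; field; exact Hmu. }
  assert (Hlim : forall (c : R -> R) (c0 c1 : R), c 0 = c0 -> is_derive c 0 c1 ->
    is_lim (fun mu => PI / 2 * (c (- mu) * bessel_series x (- mu) -
                                c mu * bessel_series x mu) / sin (mu * PI)) 0
      (- (c1 * bessel_series x 0 + c0 * D))).
  { intros c c0 c1 <- Hc.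
    apply (is_lim_reflection_quotient (fun mu => c mu * bessel_series x mu)).
    apply (is_derive_mult c (bessel_series x)); [exact Hc | exact HD |].
    intros; apply Rmult_comm. }
  assert (HRe : is_lim (fun mu => Re (BesselK_quotient mu (RtoC 2 * Csqrt (RtoC x)))) 0
    (- (l * bessel_series x 0 + 1 * D))).
  { eapply is_lim_ext_loc; [|apply (Hlim (fun mu => exp (mu * l) * cos (mu * th)))].
    - destruct sin_PI_neq_0_near_0 as [eps Heps]. exists eps. intros mu Hmu Hmu0.
      rewrite Hq by exact (Heps mu Hmu Hmu0). reflexivity.
    - rewrite !Rmult_0_l, exp_0, cos_0. ring.
    - auto_derive; [trivial|]. rewrite !Rmult_0_l, exp_0, cos_0, sin_0. ring. }
  assert (HIm : is_lim (fun mu => Im (BesselK_quotient mu (RtoC 2 * Csqrt (RtoC x)))) 0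
    (- (th * bessel_series x 0 + 0 * D))).
  { eapply is_lim_ext_loc; [|apply (Hlim (fun mu => exp (mu * l) * sin (mu * th)))].
    - destruct sin_PI_neq_0_near_0 as [eps Heps]. exists eps. intros mu Hmu Hmu0.
      rewrite Hq by exact (Heps mu Hmu Hmu0). reflexivity.
    - rewrite !Rmult_0_l, exp_0, sin_0. ring.
    - auto_derive; [trivial|]. rewrite !Rmult_0_l, exp_0, cos_0, sin_0. ring. }
  unfold CLim. rewrite (is_lim_unique _ _ _ HRe), (is_lim_unique _ _ _ HIm).
  unfold Clog. rewrite Cmod_R. unfold l, th.
  unfold Cminus, Cmult, Cplus, Copp, RtoC; simpl. fold (RtoC x). f_equal; field.
Qed.

(** * The derivative of Wi with respect to beta *)

Theorem theorem3p5 (x : R) (hx : x <> 0) :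
  ex_derive (fun beta : R => Wi 1 beta x) 0 /\
  RtoC (Derive (fun beta : R => Wi 1 beta x) 0) =
    (- RtoC euler_gamma
     - RtoC (1 / 2) * Clog (RtoC x) * BesselI 0 (RtoC 2 * Csqrt (RtoC x))
     - BesselK 0 (RtoC 2 * Csqrt (RtoC x))
     + RtoC (x * pFq [1; 1] [2; 2; 2] x))%C.
Proof.
  split; [eexists; apply is_derive_Wi_1|].
  rewrite (is_derive_unique (fun beta : R => Wi 1 beta x) 0 _ (is_derive_Wi_1 x)).
  rewrite (BesselK_0_2_Csqrt x _ hx (is_derive_bessel_series x)).
  rewrite BesselI_0_2_Csqrt, bessel_series_0 by exact hx.
  rewrite Wi_coeff_value, Wi_coeff_slope.
  repeat rewrite ?RtoC_plus, ?RtoC_minus, ?RtoC_mult. ring.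
Qed.
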